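(* Let $P$ be the transition matrix of a finite irreducible Markov chain with states $\{1,\dots,m\}$, stationary probability vector $\boldsymbol{\pi}^T=(\pi_1,\dots,\pi_m)$ and mean first passage times $\{m_{ij}\}$. Let $Z=[z_{ij}]=[I-P+\boldsymbol{e}\boldsymbol{\pi}^T]^{-1}$ be Kemeny and Snell's fundamental matrix, and let $\tau_j=\sum_{k=1}^m\pi_k m_{kj}$. Then $$z_{ij}=\begin{cases}\pi_j(\tau_j-m_{ij}), & i\neq j,\\ \pi_j\tau_j, & i=j.\end{cases}$$
   Context: $\boldsymbol{e}$ is the all-ones column vector; $\boldsymbol{\pi}^T$ is the unique stationary probability vector ($\boldsymbol{\pi}^TP=\boldsymbol{\pi}^T$, $\boldsymbol{\pi}^T\boldsymbol{e}=1$). $m_{ij}=E[T_{ij}\mid X_0=i]$, where $T_{ij}=\min\{n\ge 1: X_n=j\}$ given $X_0=i$ (first return when $i=j$); these are finite and $m_{jj}=1/\pi_j$. The matrix $I-P+\boldsymbol{e}\boldsymbol{\pi}^T$ is non-singular (known fact). *)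

(* Defs.v *)
From HB Require Import structures.
From mathcomp Require Export all_boot all_order all_algebra.
From mathcomp Require Export all_classical all_reals all_analysis.

Set Implicit Arguments.
Unset Strict Implicit.
Unset Printing Implicit Defensive.

Import Order.TTheory GRing.Theory Num.Theory.
Import numFieldNormedType.Exports.

Local Open Scope classical_set_scope.
Local Open Scope ring_scope.

(* States are 'I_m; distributions are row vectors acting on the left of P. *)

Definition ones_col (R : realType) (m : nat) : 'cV[R]_m := const_mx 1.

Definition stochastic (R : realType) (m : nat) (P : 'M[R]_m) : Prop :=
  (forall i j, 0 <= P i j) /\ P *m ones_col R m = ones_col R m.

Definition irreducible_mx (R : realType) (m : nat) (P : 'M[R]_m) : Prop :=
  forall i j : 'I_m, exists n : nat, 0 < (P ^+ n) i j.

Definition stationary (R : realType) (m : nat) (P : 'M[R]_m)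
    (pi : 'rV[R]_m) : Prop :=
  [/\ forall j, 0 <= pi 0 j, pi *m P = pi & pi *m ones_col R m = 1%:M].

(* The third condition is the time-homogeneous Markov property
     Pr (X_(n+1) = x_(n+1) | X_0 = x_0, ..., X_n = x_n) = P x_n x_(n+1),
   multiplied by the probability of the conditioning event, so that it also
   makes sense when that event is null. The initial law is not constrained. *)
Definition markov_chain (d : measure_display) (Omega : measurableType d)
    (R : realType) (Pr : probability Omega R) (m : nat) (P : 'M[R]_m)
    (X : nat -> Omega -> 'I_m) : Prop :=
  [/\ stochastic P,
      forall n i, measurable [set w | X n w = i]
    & forall (n : nat) (x : nat -> 'I_m),
        (Pr [set w | forall k, (k <= n.+1)%N -> X k w = x k]
         = Pr [set w | forall k, (k <= n)%N -> X k w = x k]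
           * (P (x n) (x n.+1))%:E)%E].

(* min {n >= 1 | X_n = j}, equal to +oo on paths that never visit j after
   time 0. *)
Definition first_passage_time (R : realType) (Omega : Type) (m : nat)
    (X : nat -> Omega -> 'I_m) (j : 'I_m) (w : Omega) : \bar R :=
  ereal_inf [set (n%:R)%:E | n in [set n : nat | (1 <= n)%N /\ X n w = j]].

(* E[T | A] for an event A of positive probability. *)
Definition cond_expectation (d : measure_display) (Omega : measurableType d)
    (R : realType) (Pr : probability Omega R) (T : Omega -> \bar R)
    (A : set Omega) : \bar R :=
  ((\int[Pr]_(w in A) T w) / Pr A)%E.

Definition mean_first_passage (d : measure_display) (Omega : measurableType d)
    (R : realType) (Pr : probability Omega R) (m : nat)
    (X : nat -> Omega -> 'I_m) (i j : 'I_m) : \bar R :=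
  cond_expectation Pr (first_passage_time R X j) [set w | X 0%N w = i].

Definition fundamental_mx (R : realType) (m : nat) (P : 'M[R]_m)
    (pi : 'rV[R]_m) : 'M[R]_m :=
  invmx (1%:M - P + ones_col R m *m pi).

Definition tau (d : measure_display) (Omega : measurableType d)
    (R : realType) (Pr : probability Omega R) (m : nat)
    (X : nat -> Omega -> 'I_m) (pi : 'rV[R]_m) (j : 'I_m) : \bar R :=
  (\sum_(k < m) (pi 0%R k)%:E * mean_first_passage Pr X k j)%E.

(* Main.v *)
(* Let q_n(i) be the probability that the chain started at i avoids j at times
   1, ..., n.  Summing tails, m_ij = sum_n q_n(i), and conditioning on the first
   step gives m_ij = 1 + sum_(k != j) P_ik m_kj in [0, +oo].  Averaging q_n over
   the stationary law telescopes to pi_j * sum_(n < N) q_n(j) <= 1, so m_jj is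
   finite; by the first-step equation finiteness passes from a state to its
   successors, hence to all states.  The same equation averaged against pi gives
   pi_j m_jj = 1, so the claimed matrix has entries
   delta_ij + pi_j (tau_j - m_ij), and the first-step equation shows that
   I - P + e pi^T maps it to the identity. *)
From mathcomp Require Import measurable_realfun ring.
Require Import Defs.
Set Implicit Arguments.
Unset Strict Implicit.
Unset Printing Implicit Defensive.
Import Order.TTheory GRing.Theory Num.Theory.
Local Open Scope classical_set_scope.
Local Open Scope ring_scope.

(** * Avoidance probabilities and their link with the paths of the chain *)

(** Row sum [i] of the [n]-th power of [P] with column [j] set to zero; the starting state may be
    [j] itself. *)
Fixpoint avoid_prob (R : realType) (m : nat) (P : 'M[R]_m) (j : 'I_m)
    (n : nat) (i : 'I_m) : R :=
  if n is n'.+1 then \sum_(k < m | k != j) P i k * avoid_prob P j n' k else 1.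

Lemma avoid_prob_ge0 (R : realType) (m : nat) (P : 'M[R]_m) (j : 'I_m) n i :
  (forall i k, 0 <= P i k) -> 0 <= avoid_prob P j n i.
Proof.
move=> P0; elim: n i => [//|n IHn] i /=.
by apply: sumr_ge0 => k _; rewrite mulr_ge0.
Qed.

(** Constraints on finitely many times fit this form: take [B n] to be everything at the other
    times. *)
Lemma measurable_path_event (d : measure_display) (Omega : measurableType d)
    (m : nat) (X : nat -> Omega -> 'I_m) (B : nat -> set 'I_m) :
  (forall n i, measurable [set w | X n w = i]) ->
  measurable [set w | forall n, B n (X n w)].
Proof.
move=> mX.
have -> : [set w | forall n, B n (X n w)]
    = \bigcap_n \bigcup_(i in B n) [set w | X n w = i].
  apply/seteqP; split => w /= Bw.
    by move=> n _; exists (X n w).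
  by move=> n; have [i Bi /= ->] := Bw n I.
apply: bigcapT_measurable => n; apply: fin_bigcup_measurable.
  exact: finite_finset.
by move=> i _; exact: mX.
Qed.

(* The path up to time n is prescribed because the chain hypothesis is stated
   for full histories only; for n = 0 this conditions on the initial state. *)
Lemma prob_avoid_after (d : measure_display) (Omega : measurableType d)
    (R : realType) (Pr : probability Omega R) (m : nat) (P : 'M[R]_m)
    (X : nat -> Omega -> 'I_m) (j : 'I_m) (N n : nat) (x : nat -> 'I_m) :
  markov_chain Pr P X ->
  (Pr [set w | (forall k, (k <= n)%N -> X k w = x k) /\
               (forall k, (n < k <= n + N)%N -> X k w != j)]
   = Pr [set w | forall k, (k <= n)%N -> X k w = x k]
     * (avoid_prob P j N (x n))%:E)%E.
Proof.
move=> [[P0 _] mX mkX]; elim: N n x => [|N IHN] n x.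
  rewrite /= mule1; congr (Pr _); apply/seteqP; split => w /=; first by case.
  by move=> ?; split=> // k; rewrite addn0 ltnNge andNb.
(* Split according to the state [i != j] at time [n.+1]: [x' i] is the history lengthened by [i], so
   the induction hypothesis applies to each [D i]. *)
pose x' (i : 'I_m) k := if (k <= n)%N then x k else i.
pose D i := [set w | (forall k, (k <= n.+1)%N -> X k w = x' i k) /\
               (forall k, (n.+1 < k <= n.+1 + N)%N -> X k w != j)].
have -> : [set w | (forall k, (k <= n)%N -> X k w = x k) /\
               (forall k, (n < k <= n + N.+1)%N -> X k w != j)]
    = \bigcup_(i in [set` [pred i | i != j]]) D i.
  apply/seteqP; split => w /=.
    case=> hx hj; exists (X n.+1 w).
      by apply: hj; rewrite ltnSn addnS ltnS leq_addr.
    split=> k; last by case/andP=> nk kN; apply: hj; rewrite -addSnnS kN ltnW.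
    by rewrite /x' leq_eqVlt => /orP[/eqP->|kn]; rewrite ?ltnn// -ltnS kn hx.
  case=> i /= ij [hx hj]; split=> k.
    by move=> kn; rewrite (hx k (leqW kn)) /x' kn.
  case/andP=> nk kN; have [->|nk'] := eqVneq k n.+1.
    by rewrite (hx n.+1)// /x' ltnn.
  by apply: hj; rewrite addSnnS kN ltn_neqAle eq_sym nk' nk.
rewrite bigcup_pred measure_bigsetU_ord_cond; last 2 first.
- move=> i _.
  pose B k := [set s | ((k <= n.+1)%N -> s = x' i k) /\
                       ((n.+1 < k <= n.+1 + N)%N -> s != j)].
  rewrite (_ : D i = [set w | forall k, B k (X k w)]).
    exact: (@measurable_path_event _ _ _ X B).
  apply/seteqP; split => w /=; first by case=> h1 h2 k; split; [exact: h1|exact: h2].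
  by move=> h; split=> k; case: (h k).
- move=> i i' _ _ [w [[/(_ n.+1 (leqnn _)) + _] [/(_ n.+1 (leqnn _)) + _]]].
  by rewrite /x' ltnn => -> ->.
have fC : Pr [set w | forall k, (k <= n)%N -> X k w = x k] \is a fin_num.
  apply: fin_num_measure.
  exact: (@measurable_path_event _ _ _ _ (fun k => [set s | (k <= n)%N -> s = x k])).
rewrite -(fineK fC) -EFinM /= mulr_sumr -sumEFin; apply: eq_bigr => i _.
rewrite /D IHN /x' ltnn mkX leqnn ltnn.
rewrite (_ : [set w | _] = [set w | forall k, (k <= n)%N -> X k w = x k]).
  by rewrite -(fineK fC) -!EFinM mulrA.
by apply/seteqP; split => w /= h k kn; have := h k kn; rewrite kn.
Qed.

(** * Passage times as sums of tails *)

(** The [n]-th indicator is that of the event that the passage time exceeds [n]. *)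
Lemma first_passage_time_series (R : realType) (Omega : Type) (m : nat)
    (X : nat -> Omega -> 'I_m) (j : 'I_m) (w : Omega) :
  first_passage_time R X j w
  = (\sum_(0 <= n <oo)
       (\1_[set w | forall k, (0 < k <= n)%N -> X k w != j] w : R)%:E)%E.
Proof.
rewrite /first_passage_time.
have [hit|nohit] := pselect (exists n, (0 < n)%N && (X n w == j)).
  case: (ex_minnP hit) => n /andP[n0 /eqP Xn] nmin.
  transitivity ((n%:R : R)%:E).
    apply/eqP; rewrite eq_le; apply/andP; split.
      by apply: ereal_inf_lbound; exists n.
    apply: le_ereal_inf_tmp.
    move=> _ [k [k0 Xk] <-]; rewrite lee_fin ler_nat; apply: nmin.
    by rewrite k0 Xk eqxx.
  (* With [n] the first hitting time, the terms below [n] are 1 and the others vanish. *)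
  rewrite (nneseries_split 0 n) ?add0n; last by move=> k _; rewrite lee_fin.
  rewrite [X in (_ + X)%E]eseries0 ?adde0; last first.
    move=> k nk _; rewrite indicE memNset//= => /(_ n).
    by rewrite n0 nk Xn eqxx => /(_ isT).
  rewrite sumEFin; congr (_%:E).
  rewrite (eq_big_nat _ _ (F2 := fun=> 1)); last first.
    move=> k /andP[_ kn]; rewrite indicE mem_set//= => l /andP[l0 lk].
    apply/negP => /eqP Xl; have := nmin l; rewrite l0 Xl eqxx => /(_ isT).
    by rewrite leqNgt (leq_ltn_trans lk kn).
  by rewrite sumr_const_nat subn0.
(* Without a hit, the infimum over the empty set is [+oo], and a series of ones diverges. *)
rewrite (_ : [set _ | n in _] = set0); last first.
  apply/seteqP; split => // _ [n [n0 Xn] <-]; apply: nohit.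
  by exists n; rewrite n0 Xn eqxx.
rewrite ereal_inf0; apply/esym.
have one n : (\1_[set w | forall k, (0 < k <= n)%N -> X k w != j] w : R) = 1.
  rewrite indicE mem_set//= => k /andP[k0 _]; apply/negP => Xk.
  by apply: nohit; exists k; rewrite k0.
under eq_eseriesr do rewrite one.
apply/eqyP => A A0.
apply: le_trans (nneseries_lim_ge (Num.truncn A).+1 _); last by [].
by rewrite sumEFin lee_fin sumr_const_nat subn0 ltW// truncnS_gt.
Qed.

Lemma mean_first_passage_series (d : measure_display) (Omega : measurableType d)
    (R : realType) (Pr : probability Omega R) (m : nat) (P : 'M[R]_m)
    (X : nat -> Omega -> 'I_m) (i j : 'I_m) :
  markov_chain Pr P X -> (0 < Pr [set w | X 0%N w = i])%E ->
  mean_first_passage Pr X i j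
  = (\sum_(0 <= n <oo) (avoid_prob P j n i)%:E)%E.
Proof.
move=> mcX X0i; have [[P0 _] mX _] := mcX.
set A := [set w | X 0%N w = i]; have mA : measurable A by exact: mX.
have fA : Pr A \is a fin_num by exact: fin_num_measure.
pose E n := [set w | forall k, (0 < k <= n)%N -> X k w != j].
have mE n : measurable (E n).
  exact: (@measurable_path_event _ _ _ X (fun k => [set s | (0 < k <= n)%N -> s != j])).
rewrite /mean_first_passage /cond_expectation -/A.
under eq_integral do rewrite first_passage_time_series.
(* Monotone convergence: the exchange is valid even if the value is infinite. *)
rewrite integral_nneseries//; last first.
  by move=> n; apply/measurable_EFinP; apply: measurable_indic; exact: mE.
have AE n : (\int[Pr]_(w in A) (\1_(E n) w)%:E)%E
            = (fine (Pr A) * avoid_prob P j n i)%:E.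
  rewrite integral_indic// EFinM (fineK fA).
  transitivity (Pr [set w | (forall k, (k <= 0)%N -> X k w = (fun=> i) k) /\
                  (forall k, (0 < k <= 0 + n)%N -> X k w != j)]).
    congr (Pr _); apply/seteqP; split => w /=.
      by move=> [hE hA]; split=> // k; rewrite leqn0 => /eqP ->.
    by move=> [hA hE]; split => //; exact: hA.
  rewrite (prob_avoid_after _ _ _ _ mcX); congr (Pr _ * _)%E.
  apply/seteqP; split => w /=; first by move=> /(_ 0%N (leqnn _)).
  by move=> hA k; rewrite leqn0 => /eqP ->.
rewrite (eq_eseriesr (fun n _ => AE n)).
under eq_eseriesr do rewrite EFinM.
rewrite nneseriesZl; last by move=> n _; rewrite lee_fin avoid_prob_ge0.
by rewrite (fineK fA) muleAC divee ?mul1e// gt_eqF.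
Qed.

(** First-step equation in [[0, +oo]]: the term [n = 0] gives 1, and nonnegativity lets the shifted
    series be exchanged with the finite sum. *)
Lemma avoid_series_rec (R : realType) (m : nat) (P : 'M[R]_m) (i j : 'I_m) :
  (forall i k, 0 <= P i k) ->
  (\sum_(0 <= n <oo) (avoid_prob P j n i)%:E
   = 1 + \sum_(k < m | k != j)
           (P i k)%:E * \sum_(0 <= n <oo) (avoid_prob P j n k)%:E)%E.
Proof.
move=> P0; have q0 n k : (0 <= (avoid_prob P j n k)%:E)%E.
  by rewrite lee_fin avoid_prob_ge0.
rewrite nneseries_recl//; congr (_ + _)%E.
rewrite -nneseries_addn//; under eq_eseriesr do rewrite addn1 /= -sumEFin.
rewrite nneseries_sum; last by move=> k n _; rewrite lee_fin mulr_ge0 ?avoid_prob_ge0.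
apply: eq_bigr => k _; under eq_eseriesr do rewrite EFinM.
by rewrite nneseriesZl.
Qed.

(** * The stationary law and finiteness of the mean passage times *)

Lemma row_mulmx_exp (R : realType) (m : nat) (P : 'M[R]_m) (pi : 'rV[R]_m) n :
  pi *m P = pi -> pi *m P ^+ n = pi.
Proof. by move=> piP; elim: n => [|n IHn]; rewrite ?mulmx1// exprS mulmxA piP. Qed.

Lemma expmx_ge0 (R : realType) (m : nat) (P : 'M[R]_m) n :
  (forall i k, 0 <= P i k) -> forall i k, 0 <= (P ^+ n) i k.
Proof.
move=> P0; elim: n => [|n IHn] i k; first by rewrite mxE ler0n.
by rewrite exprS mxE sumr_ge0// => l _; rewrite mulr_ge0.
Qed.

Lemma stationary_sum1 (R : realType) (m : nat) (P : 'M[R]_m) (pi : 'rV[R]_m) :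
  stationary P pi -> \sum_i pi 0 i = 1.
Proof.
case=> _ _ /matrixP/(_ 0 0); rewrite !mxE eqxx mulr1n => <-.
by apply: eq_bigr => i _; rewrite mxE mulr1.
Qed.

(** Some state carries mass, and a power of [P], which preserves [pi], moves part of that mass to
    [j]. *)
Lemma stationary_gt0 (R : realType) (m : nat) (P : 'M[R]_m) (pi : 'rV[R]_m)
    (j : 'I_m) :
  (forall i k, 0 <= P i k) -> irreducible_mx P -> stationary P pi ->
  0 < pi 0 j.
Proof.
move=> P0 irrP st; have [pi0 piP _] := st.
have [i pii] : exists i, 0 < pi 0 i.
  apply: contrapT => /forallNP npi; have := stationary_sum1 st.
  rewrite big1 => [/esym/eqP|i _]; first by rewrite oner_eq0.
  by apply/eqP; rewrite eq_le pi0 andbT leNgt; apply/negP.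
have [n Pn] := irrP i j.
rewrite -(row_mulmx_exp n piP) mxE (bigD1 i)//=.
rewrite ltr_wpDr ?mulr_gt0//; apply: sumr_ge0 => k _.
by rewrite mulr_ge0// expmx_ge0.
Qed.

(* Under the stationary law, the chance of avoiding [j] up to time [N] drops at
   step [n] by the chance of starting at [j] and not being back by time [n]. *)
Lemma stationary_avoid (R : realType) (m : nat) (P : 'M[R]_m) (pi : 'rV[R]_m)
    (j : 'I_m) (N : nat) :
  stationary P pi ->
  pi 0 j * (\sum_(0 <= n < N) avoid_prob P j n j)
  = 1 - \sum_i pi 0 i * avoid_prob P j N i.
Proof.
move=> st; have [_ /matrixP/(_ 0) piP _] := st.
elim: N => [|N IHN].
  rewrite big_geq// mulr0 -(stationary_sum1 st).
  by under [X in _ - X]eq_bigr do rewrite mulr1; rewrite subrr.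
rewrite big_nat_recr//= mulrDr IHN -addrA; congr (_ + _).
under [X in _ = - X]eq_bigr do rewrite mulr_sumr.
rewrite exchange_big /= (bigD1 j)//= opprD addrC addNKr; congr (- _).
apply: eq_bigr => k _; rewrite -[in LHS]piP mxE mulr_suml.
by apply: eq_bigr => i _; rewrite mulrA.
Qed.

Lemma avoid_series_fin_num (R : realType) (m : nat) (P : 'M[R]_m)
    (pi : 'rV[R]_m) (i j : 'I_m) :
  (forall i k, 0 <= P i k) -> irreducible_mx P -> stationary P pi ->
  (\sum_(0 <= n <oo) (avoid_prob P j n i)%:E)%E \is a fin_num.
Proof.
move=> P0 irrP st.
have q0 n k : (0 <= (avoid_prob P j n k)%:E)%E.
  by rewrite lee_fin avoid_prob_ge0.
pose h k := (\sum_(0 <= n <oo) (avoid_prob P j n k)%:E)%E.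
have h0 k : (0 <= h k)%E by exact: nneseries_ge0.
have pij := stationary_gt0 j P0 irrP st.
(* The partial sums at [j] are bounded by the inverse of [pi 0 j]. *)
have hj : (h j < +oo)%E.
  apply: (@le_lt_trans _ _ ((pi 0 j)^-1)%:E); last exact: ltry.
  apply: lime_le; first exact: is_cvg_nneseries.
  apply: nearW => N; rewrite sumEFin lee_fin -[leRHS]mul1r ler_pdivlMr// mulrC.
  rewrite (stationary_avoid j N st) gerBl sumr_ge0// => k _.
  by rewrite mulr_ge0 ?avoid_prob_ge0//; case: st.
(* If [h l] were infinite with [l != j], the summand [l] of the first-step equation would make [h k]
   infinite. *)
have step k l : (h k < +oo)%E -> 0 < P k l -> (h l < +oo)%E.
  move=> hk Pkl; have [->//|lj] := eqVneq l j.
  rewrite ltey; apply/eqP => hl; move: hk.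
  rewrite /h avoid_series_rec// (bigD1 l)//= -/(h l) hl gt0_muley ?lte_fin//.
  rewrite addye ?addey// gt_eqF// (lt_le_trans (ltNyr 0))// sume_ge0// => k' _.
  by apply: mule_ge0; [rewrite lee_fin|exact: h0].
rewrite -/(h i) ge0_fin_numE//; have [n] := irrP j i.
(* Induction on the length of a path from [j], peeling off its last transition. *)
elim: n (i) => [|n IHn] l.
  by rewrite mxE; case: eqVneq => [<-//|]; rewrite ltxx.
rewrite exprSr mxE => /lt0r_neq0/eqP/psumr_neq0P[k _|k /= ].
  by rewrite mulr_ge0// expmx_ge0.
rewrite lt0r mulf_eq0 negb_or -andbA => /and3P[Pjk Pkl _].
by apply: (step k); [apply: IHn; rewrite lt0r Pjk expmx_ge0|rewrite lt0r Pkl P0].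
Qed.

(** * Matrix algebra from the first-step equation *)

(** Averaging the equation against [pi] reproduces every [pi 0 k * h k] with [k != j] on both sides;
    only the term at [j] survives. *)
Lemma stationary_return_time (R : realType) (m : nat) (P : 'M[R]_m)
    (pi : 'rV[R]_m) (j : 'I_m) (h : 'I_m -> R) :
  stationary P pi ->
  (forall i, h i = 1 + \sum_(k < m | k != j) P i k * h k) ->
  pi 0 j * h j = 1.
Proof.
move=> st hrec; have [_ piP _] := st.
have E : \sum_i pi 0 i * h i = 1 + \sum_(k < m | k != j) pi 0 k * h k.
  under eq_bigr do rewrite hrec mulrDr mulr1 mulr_sumr.
  rewrite big_split /= (stationary_sum1 st) exchange_big; congr (_ + _).
  apply: eq_bigr => k _; rewrite -[in RHS]piP mxE mulr_suml.
  by apply: eq_bigr => i _; rewrite mulrA.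
by move: E; rewrite (bigD1 j)//= => /addIr.
Qed.

Lemma mulmx_add_ones_stationary (R : realType) (m : nat) (P : 'M[R]_m)
    (pi : 'rV[R]_m) (h : 'I_m -> 'I_m -> R) :
  stochastic P -> stationary P pi ->
  (forall i j, h i j = 1 + \sum_(k < m | k != j) P i k * h k j) ->
  (1%:M - P + ones_col R m *m pi) *m
    (\matrix_(i, j) ((i == j)%:R + pi 0 j * (\sum_k pi 0 k * h k j - h i j)))
  = 1%:M.
Proof.
move=> [_ P1] st hrec; have pi1 := stationary_sum1 st.
have Psum i : \sum_k P i k = 1.
  have /matrixP/(_ i 0) := P1; rewrite !mxE => <-.
  by apply: eq_bigr => k _; rewrite mxE mulr1.
have Ph i j : \sum_k P i k * h k j = h i j - 1 + P i j * h j j.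
  by rewrite (bigD1 j)//= [in RHS](hrec i j); ring.
have pih j : pi 0 j * h j j = 1.
  exact: (stationary_return_time st (hrec ^~ j)).
apply/matrixP => i j; set t := \sum_k pi 0 k * h k j.
transitivity (\sum_k ((i == k)%:R - P i k + pi 0 k) *
                 ((k == j)%:R + pi 0 j * (t - h k j))).
  rewrite !mxE; apply: eq_bigr => k _; rewrite !mxE; congr (_ * _).
  by rewrite big_ord1 !mxE mul1r.
have delta (f : 'I_m -> R) (l : 'I_m) : \sum_k f k * (k == l)%:R = f l.
  rewrite (bigD1 l)//= eqxx mulr1 big1 ?addr0// => k kl.
  by rewrite (negbTE kl) mulr0.
have deltal (f : 'I_m -> R) (l : 'I_m) : \sum_k (l == k)%:R * f k = f l.
  by rewrite -[RHS]delta; apply: eq_bigr => k _; rewrite mulrC eq_sym.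
(* The factor of [t] is a row sum of the first matrix, namely [1 - 1 + 1]. *)
transitivity ((i == j)%:R - P i j + pi 0 j
  + pi 0 j * (t * (\sum_k (i == k)%:R - \sum_k P i k + \sum_k pi 0 k)
              - (\sum_k (i == k)%:R * h k j - \sum_k P i k * h k j
                 + \sum_k pi 0 k * h k j))).
  rewrite -[X in _ = X + _](delta (fun k => (i == k)%:R - P i k + pi 0 k)).
  rewrite -!(sumrB, big_split) /= mulr_sumr -sumrB mulr_sumr -big_split /=.
  by apply: eq_bigr => k _; ring.
rewrite (deltal (h^~ j)) Ph Psum pi1 mxE -/t.
have -> : \sum_k (i == k)%:R = 1 :> R.
  by rewrite -[RHS](deltal (fun=> 1) i); apply: eq_bigr => k _; rewrite mulr1.
transitivity ((i == j)%:R + P i j * (pi 0 j * h j j - 1)); first by ring.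
by rewrite pih subrr mulr0 addr0.
Qed.

Theorem corollary11p6 (R : realType) (d : measure_display)
    (Omega : measurableType d) (Pr : probability Omega R)
    (m : nat) (P : 'M[R]_m) (X : nat -> Omega -> 'I_m) (pi : 'rV[R]_m)
    (chainX : markov_chain Pr P X)
    (irrP : irreducible_mx P)
    (X0_gt0 : forall i : 'I_m, (0 < Pr [set w | X 0%N w = i])%E)
    (pi_stat : stationary P pi)
    (i j : 'I_m) :
  ((fundamental_mx P pi i j)%:E
   = if i == j then (pi 0%R j)%:E * tau Pr X pi j
     else (pi 0%R j)%:E * (tau Pr X pi j - mean_first_passage Pr X i j))%E.
Proof.
have [stP _ _] := chainX; have [P0 _] := stP.
(* The series are finite, so [fine] loses nothing and the algebra can take place in [R]. *)
pose h k l := fine (\sum_(0 <= n <oo) (avoid_prob P l n k)%:E)%E.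
have hE k l : ((h k l)%:E = \sum_(0 <= n <oo) (avoid_prob P l n k)%:E)%E.
  by rewrite fineK// (avoid_series_fin_num _ _ _ irrP pi_stat).
have mE k l : mean_first_passage Pr X k l = (h k l)%:E.
  by rewrite (mean_first_passage_series _ chainX)// hE.
have tauE l : tau Pr X pi l = (\sum_k pi 0 k * h k l)%:E.
  by rewrite /tau -sumEFin; apply: eq_bigr => k _; rewrite mE EFinM.
have hrec k l : h k l = 1 + \sum_(k' < m | k' != l) P k k' * h k' l.
  apply: EFin_inj; rewrite hE avoid_series_rec// EFinD -sumEFin.
  by congr (_ + _)%E; apply: eq_bigr => k' _; rewrite EFinM hE.
have ZE := mulmx_add_ones_stationary stP pi_stat hrec.
(* A right inverse of a square matrix makes it a unit, so [invmx] is its true inverse. *)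
have [uA _] := mulmx1_unit ZE.
have := congr1 (mulmx (invmx (1%:M - P + ones_col R m *m pi))) ZE.
rewrite mulKmx// mulmx1 /fundamental_mx => <-; rewrite mxE tauE mE.
(* On the diagonal, the 1 from the identity matrix cancels [pi 0 i * h i i]. *)
case: eqVneq => [<-|_]; last by rewrite add0r EFinM EFinB.
have pih : pi 0 i * h i i = 1.
  exact: (stationary_return_time pi_stat (hrec ^~ i)).
by rewrite mulrBr pih addrC subrK EFinM.
Qed.
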